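(* Let $\Gamma$ be a split-by-nilpotent extension of $\Lambda$ by the two-sided ideal $I$ of $\Gamma$, and let $G={}_\Gamma\Gamma_\Lambda\otimes_\Lambda-:\mathrm{mod}(\Lambda)\to\mathrm{mod}(\Gamma)$. Let $\Theta=\{\Theta(i)\}_{i=1}^t$ be a family of objects in $\mathrm{mod}(\Lambda)$ and let $\leq$ be a linear order on $[1,t]=\{1,\dots,t\}$. If the right $\Lambda$-module $I_\Lambda$ is projective, then the following conditions are equivalent. (a) $(G(\Theta),\leq)$ is a stratifying system in $\mathrm{mod}(\Gamma)$, where $G(\Theta)=\{G(\Theta(i))\}_{i=1}^t$. (b) $(\Theta,\leq)$ is a stratifying system in $\mathrm{mod}(\Lambda)$ which is compatible with the ideal $I$.
   Context: Algebra means artin algebra over a commutative artinian ring $R$; $\mathrm{mod}(\Lambda)$ is the category of finitely generated left $\Lambda$-modules. Given algebras $\Gamma,\Lambda$ and a two-sided ideal $I$ of $\Gamma$, $\Gamma$ is a split-by-nilpotent extension of $\Lambda$ by $I$ if $I\subseteq\mathrm{rad}(\Gamma)$ and there is an exact sequence of abelian groups $0\to I\to\Gamma\xrightarrow{\pi}\Lambda\to 0$ such that $\pi$ is an epimorphism of algebras and there is a morphism of algebras $\sigma:\Lambda\to\Gamma$ with $\pi\sigma=1_\Lambda$. Through $\sigma$, $\Gamma$ and $I$ are $\Lambda$-$\Lambda$-bimodules. A stratifying system $(\Theta,\leq)$ of size $t$ in $\mathrm{mod}(\Lambda)$ consists of a family of indecomposable $\Lambda$-modules $\Theta=\{\Theta(i)\}_{i=1}^t$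 and a linear order $\leq$ on $[1,t]$ such that $\mathrm{Hom}_\Lambda(\Theta(i),\Theta(j))=0$ if $i>j$, and $\mathrm{Ext}^1_\Lambda(\Theta(i),\Theta(j))=0$ if $i\geq j$. (Inequalities between indices always refer to the given linear order.) A stratifying system $(\Theta,\leq)$ in $\mathrm{mod}(\Lambda)$ is compatible with the ideal $I$ of $\Gamma$ if (C1) $\mathrm{Hom}_\Lambda(\Theta(j),I\otimes_\Lambda\Theta(i))=0$ for $j>i$, and (C2) $\mathrm{Ext}^1_\Lambda(\Theta(j),I\otimes_\Lambda\Theta(i))=0$ for $j\geq i$. *)

(* Defs.v *)
From HB Require Import structures.
From mathcomp Require Import all_boot all_order all_algebra.
From mathcomp Require Import boolp classical_sets.

Set Implicit Arguments.
Unset Strict Implicit.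
Unset Printing Implicit Defensive.

Import GRing.Theory.
Local Open Scope ring_scope.
Local Open Scope classical_set_scope.

Definition left_ideal (A : pzRingType) (J : set A) : Prop :=
  [/\ J 0, (forall x y, J x -> J y -> J (x + y)) &
      (forall a x, J x -> J (a * x))].

Definition left_artinian (A : pzRingType) : Prop :=
  forall J : nat -> set A,
    (forall n, left_ideal (J n)) -> (forall n, J n.+1 `<=` J n) ->
  exists n, forall m, (n <= m)%N -> J m = J n.

Definition finitely_generated (A : pzRingType) (M : lmodType A) : Prop :=
  exists n (e : 'I_n -> M),
    forall x : M, exists c : 'I_n -> A, x = \sum_(i < n) c i *: e i.

Definition artin_algebra (R : comNzRingType) (A : algType R) : Prop :=
  left_artinian R /\ @finitely_generated R A.

Definition maximal_left_ideal (A : pzRingType) (J : set A) : Prop :=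
  [/\ left_ideal J, J <> setT &
      forall K : set A, left_ideal K -> J `<=` K -> K = J \/ K = setT].

Definition jacobson_radical (A : pzRingType) : set A :=
  [set x | forall J : set A, maximal_left_ideal J -> J x].

Definition hom_zero (A : pzRingType) (M N : lmodType A) : Prop :=
  forall (f : {linear M -> N}) (x : M), f x = 0.

Definition injl (A : pzRingType) (M N : lmodType A) (x : M) : M * N := (x, 0).

Section Injl.
Variables (A : pzRingType) (M N : lmodType A).

Fact injl_is_linear : linear (@injl A M N).
Proof.
move=> a x y; rewrite /injl; congr pair.
by rewrite /= scaler0 addr0.
Qed.

HB.instance Definition _ :=
  GRing.isLinear.Build A M (M * N)%type *:%R (@injl A M N) injl_is_linear.
End Injl.

(* Short exact sequences 0 -> N -> E -> M -> 0; [Ext^1(M, N)] is taken in the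
   sense of Yoneda, as the equivalence classes of such sequences, with the
   class of the split sequence N -> N (+) M -> M as zero element. *)
Record extension (A : pzRingType) (M N : lmodType A) := Extension {
  ext_mid : lmodType A;
  ext_inj : {linear N -> ext_mid};
  ext_proj : {linear ext_mid -> M};
  ext_injI : injective ext_inj;
  ext_projS : forall x, exists e, ext_proj e = x;
  ext_exact : forall e, ext_proj e = 0 <-> exists y, ext_inj y = e
}.

Definition ext_equiv (A : pzRingType) (M N : lmodType A)
    (E F : extension M N) : Prop :=
  exists phi : {linear ext_mid E -> ext_mid F},
    [/\ bijective phi,
        (forall y, phi (ext_inj E y) = ext_inj F y) &
        (forall e, ext_proj F (phi e) = ext_proj E e)].

Section SplitExtension.
Variables (A : pzRingType) (M N : lmodType A).

Fact split_injI : injective (@injl A N M).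
Proof. by move=> x y []. Qed.

Fact split_projS (x : M) : exists e : N * M, e.2 = x.
Proof. by exists (0, x). Qed.

Fact split_exact (e : N * M) : e.2 = 0 <-> exists y, injl M y = e.
Proof.
case: e => y x /=; split=> [-> | [z] [_ <-]]; last by [].
by exists y.
Qed.

Definition split_extension : extension M N :=
  @Extension A M N (N * M)%type (@injl A N M) snd
    split_injI split_projS split_exact.
End SplitExtension.

Definition ext1_zero (A : pzRingType) (M N : lmodType A) : Prop :=
  forall E : extension M N, ext_equiv E (split_extension M N).

Definition zero_module (A : pzRingType) (M : lmodType A) : Prop :=
  forall x : M, x = 0.

Definition isomorphic (A : pzRingType) (M N : lmodType A) : Prop :=
  exists f : {linear M -> N}, bijective f.

Definition indecomposable (A : pzRingType) (M : lmodType A) : Prop :=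
  ~ zero_module M /\
  forall N1 N2 : lmodType A, isomorphic M (N1 * N2)%type ->
    zero_module N1 \/ zero_module N2.

Definition projective_module (A : pzRingType) (P : lmodType A) : Prop :=
  forall (M N : lmodType A) (g : {linear M -> N}) (f : {linear P -> N}),
    (forall y, exists x, g x = y) ->
  exists h : {linear P -> M}, forall x, g (h x) = f x.

HB.mixin Record Lmodule_hasRightAction (A B : pzRingType) V
    of GRing.Lmodule A V := {
  rscale : V -> B -> V;
  rscaleA : forall v b c, rscale (rscale v b) c = rscale v (b * c);
  rscale1 : forall v, rscale v 1 = v;
  rscaleDl : forall u v b, rscale (u + v) b = rscale u b + rscale v b;
  rscaleDr : forall v b c, rscale v (b + c) = rscale v b + rscale v c;
  scale_rscale : forall (a : A) v b, a *: rscale v b = rscale (a *: v) b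
}.

#[short(type="bimodType")]
HB.structure Definition Bimodule (A B : pzRingType) :=
  { V of GRing.Lmodule A V & Lmodule_hasRightAction A B V }.

(* The underlying right B-module of an A-B-bimodule, as a left module over the
   converse ring. *)
Definition right_module (A B : pzRingType) (V : bimodType A B) : Type := V.

Section RightModule.
Variables (A B : pzRingType) (V : bimodType A B).

HB.instance Definition _ := GRing.Zmodule.on (right_module V).

Let scale (b : B^c) (v : right_module V) : right_module V :=
  rscale (v : V) (b : B).

Fact right_scaleA a b v : scale a (scale b v) = scale (a * b) v.
Proof. exact: rscaleA. Qed.
Fact right_scale1 : left_id 1 scale.
Proof. exact: rscale1. Qed.
Fact right_scaleDr : right_distributive scale +%R.
Proof. by move=> b u v; apply: rscaleDl. Qed.
Fact right_scaleDl v : {morph scale^~ v : a b / a + b}.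
Proof. by move=> a b; apply: rscaleDr. Qed.

HB.instance Definition _ := GRing.Zmodule_isLmodule.Build B^c (right_module V)
  right_scaleA right_scale1 right_scaleDr right_scaleDl.
End RightModule.

HB.instance Definition _ (A : pzRingType) :=
  Lmodule_hasRightAction.Build A A A^o
    (fun v b c => esym (mulrA v b c)) (@mulr1 A) (@mulrDl A) (@mulrDr A)
    (fun a v b => mulrA a v b).

Definition restr (A A' B B' : pzRingType) (f : {rmorphism A' -> A})
  (g : {rmorphism B' -> B}) (V : bimodType A B) : Type := V.

Section Restr.
Variables (A A' B B' : pzRingType) (f : {rmorphism A' -> A}).
Variables (g : {rmorphism B' -> B}) (V : bimodType A B).

HB.instance Definition _ := GRing.Zmodule.on (restr f g V).

Let scale (a : A') (v : restr f g V) : restr f g V := f a *: (v : V).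

Fact restr_scaleA a b v : scale a (scale b v) = scale (a * b) v.
Proof. by rewrite /scale scalerA rmorphM. Qed.
Fact restr_scale1 : left_id 1 scale.
Proof. by move=> v; rewrite /scale rmorph1 scale1r. Qed.
Fact restr_scaleDr : right_distributive scale +%R.
Proof. by move=> a u v; apply: scalerDr. Qed.
Fact restr_scaleDl v : {morph scale^~ v : a b / a + b}.
Proof. by move=> a b; rewrite /scale rmorphD; apply: scalerDl. Qed.

HB.instance Definition _ := GRing.Zmodule_isLmodule.Build A' (restr f g V)
  restr_scaleA restr_scale1 restr_scaleDr restr_scaleDl.

Let rsc (v : restr f g V) (b : B') : restr f g V := rscale (v : V) (g b).

Fact restr_rscaleA v b c : rsc (rsc v b) c = rsc v (b * c).
Proof. by rewrite /rsc rscaleA rmorphM. Qed.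
Fact restr_rscale1 v : rsc v 1 = v.
Proof. by rewrite /rsc rmorph1 rscale1. Qed.
Fact restr_rscaleDl u v b : rsc (u + v) b = rsc u b + rsc v b.
Proof. exact: rscaleDl. Qed.
Fact restr_rscaleDr v b c : rsc v (b + c) = rsc v b + rsc v c.
Proof. by rewrite /rsc rmorphD; apply: rscaleDr. Qed.
Fact restr_scale_rscale (a : A') v b : a *: rsc v b = rsc (a *: v) b.
Proof. exact: scale_rscale. Qed.

HB.instance Definition _ := Lmodule_hasRightAction.Build A' B' (restr f g V)
  restr_rscaleA restr_rscale1 restr_rscaleDl restr_rscaleDr restr_scale_rscale.
End Restr.

Record twosided_ideal (A : pzRingType) := TwosidedIdeal {
  ideal_pred :> {pred A};
  ideal0 : 0 \in ideal_pred;
  idealD : {in ideal_pred &, forall x y, x + y \in ideal_pred};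
  idealMl : forall a x, x \in ideal_pred -> a * x \in ideal_pred;
  idealMr : forall x a, x \in ideal_pred -> x * a \in ideal_pred
}.

Record ideal_sort (A : pzRingType) (I : twosided_ideal A) :=
  IdealSort { ideal_val : A; ideal_valP : ideal_val \in ideal_pred I }.

Section IdealSort.
Variables (A : pzRingType) (I : twosided_ideal A).

Fact ideal_zmod_closed : zmod_closed (ideal_pred I).
Proof.
split=> [|x y xI yI]; first exact: ideal0.
by rewrite -mulN1r; apply: idealD => //; apply: idealMl.
Qed.

HB.instance Definition _ :=
  GRing.isZmodClosed.Build A (ideal_pred I) ideal_zmod_closed.
HB.instance Definition _ := [isSub for @ideal_val A I].
HB.instance Definition _ := [Choice of ideal_sort I by <:].
HB.instance Definition _ := [SubChoice_isSubZmodule of ideal_sort I by <:].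

Let scale (a : A) (x : ideal_sort I) : ideal_sort I :=
  IdealSort (idealMl a (ideal_valP x)).
Let rsc (x : ideal_sort I) (a : A) : ideal_sort I :=
  IdealSort (idealMr a (ideal_valP x)).

Fact ideal_scaleA a b v : scale a (scale b v) = scale (a * b) v.
Proof. by apply: val_inj; apply: mulrA. Qed.
Fact ideal_scale1 : left_id 1 scale.
Proof. by move=> v; apply: val_inj; apply: mul1r. Qed.
Fact ideal_scaleDr : right_distributive scale +%R.
Proof. by move=> a u v; apply: val_inj; apply: mulrDr. Qed.
Fact ideal_scaleDl v : {morph scale^~ v : a b / a + b}.
Proof. by move=> a b; apply: val_inj; apply: mulrDl. Qed.

HB.instance Definition _ := GRing.Zmodule_isLmodule.Build A (ideal_sort I)
  ideal_scaleA ideal_scale1 ideal_scaleDr ideal_scaleDl.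

Fact ideal_rscaleA v b c : rsc (rsc v b) c = rsc v (b * c).
Proof. by apply: val_inj; rewrite /= mulrA. Qed.
Fact ideal_rscale1 v : rsc v 1 = v.
Proof. by apply: val_inj; apply: mulr1. Qed.
Fact ideal_rscaleDl u v b : rsc (u + v) b = rsc u b + rsc v b.
Proof. by apply: val_inj; apply: mulrDl. Qed.
Fact ideal_rscaleDr v b c : rsc v (b + c) = rsc v b + rsc v c.
Proof. by apply: val_inj; apply: mulrDr. Qed.
Fact ideal_scale_rscale (a : A) v b : a *: rsc v b = rsc (a *: v) b.
Proof. by apply: val_inj; apply: mulrA. Qed.

HB.instance Definition _ := Lmodule_hasRightAction.Build A A (ideal_sort I)
  ideal_rscaleA ideal_rscale1 ideal_rscaleDl ideal_rscaleDr ideal_scale_rscale.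
End IdealSort.

Section Tensor.
Variables (A B : pzRingType) (V : bimodType A B) (M : lmodType B).

(* A list [:: (v1, m1); ..; (vk, mk)] stands for the formal sum of the
   vi (x) mi: the tensor product is the free commutative monoid on V x M modulo
   the congruence generated by the biadditivity and balancing relations.  The
   relation 0 (x) m = 0 makes (- v) (x) m the opposite of v (x) m, so that the
   quotient is already a group and no formal differences are needed. *)
Inductive tensor_rel : seq (V * M) -> seq (V * M) -> Prop :=
| tensor_refl s : tensor_rel s s
| tensor_sym s1 s2 : tensor_rel s1 s2 -> tensor_rel s2 s1
| tensor_trans s1 s2 s3 :
    tensor_rel s1 s2 -> tensor_rel s2 s3 -> tensor_rel s1 s3
| tensor_cat s1 s2 t1 t2 :
    tensor_rel s1 t1 -> tensor_rel s2 t2 -> tensor_rel (s1 ++ s2) (t1 ++ t2)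
| tensor_catC s1 s2 : tensor_rel (s1 ++ s2) (s2 ++ s1)
| tensor_0l m : tensor_rel [:: (0, m)] [::]
| tensor_Dl u v m : tensor_rel [:: (u + v, m)] [:: (u, m); (v, m)]
| tensor_Dr v m n : tensor_rel [:: (v, m + n)] [:: (v, m); (v, n)]
| tensor_bal v b m : tensor_rel [:: (rscale v b, m)] [:: (v, b *: m)].

Let rel (s1 s2 : seq (V * M)) : bool := `[< tensor_rel s1 s2 >].

Fact tensor_rel_equiv : equiv_class_of rel.
Proof.
split=> [s | s1 s2 | s2 s1 s3].
- by apply/asboolP; apply: tensor_refl.
- by apply/asboolP/asboolP; apply: tensor_sym.
- move=> /asboolP r12 /asboolP r23; apply/asboolP; exact: tensor_trans r12 r23.
Qed.

Canonical tensor_equiv := EquivRelPack tensor_rel_equiv.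

Definition tensor : Type := {eq_quot rel}%qT.

HB.instance Definition _ := Choice.on tensor.
HB.instance Definition _ := Quotient.on tensor.

Definition tclass (s : seq (V * M)) : tensor := (\pi_tensor s)%qT.
Definition trepr (x : tensor) : seq (V * M) := repr x.

Lemma treprK x : tclass (trepr x) = x.
Proof. exact: reprK. Qed.

Lemma tclassP s1 s2 : tclass s1 = tclass s2 <-> tensor_rel s1 s2.
Proof.
split=> [/(@eqquotP _ rel) /asboolP // | r12].
by apply/(@eqquotP _ rel)/asboolP.
Qed.

Lemma treprP s : tensor_rel (trepr (tclass s)) s.
Proof. by apply/tclassP; rewrite treprK. Qed.

Let tadd x y := tclass (trepr x ++ trepr y).
Let topp x := tclass [seq (- p.1, p.2) | p <- trepr x].
Let tscale a x := tclass [seq (a *: p.1, p.2) | p <- trepr x].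

Fact tadd_class s1 s2 : tadd (tclass s1) (tclass s2) = tclass (s1 ++ s2).
Proof. by apply/tclassP; apply: tensor_cat; apply: treprP. Qed.

Lemma tensor_rel_map (f : V -> V) s1 s2 :
  {morph f : u v / u + v} -> (forall v b, f (rscale v b) = rscale (f v) b) ->
  tensor_rel s1 s2 ->
  tensor_rel [seq (f p.1, p.2) | p <- s1] [seq (f p.1, p.2) | p <- s2].
Proof.
move=> fD fr; elim=> {s1 s2} [s | s1 s2 _ | s1 s2 s3 _ r12 _ | s1 s2 t1 t2 _ r1 _ r2
  | s1 s2 | m | u v m | v m n | v b m] /=.
- exact: tensor_refl.
- exact: tensor_sym.
- exact: tensor_trans.
- by rewrite !map_cat; apply: tensor_cat.
- by rewrite !map_cat; apply: tensor_catC.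
- suff -> : f 0 = 0 by apply: tensor_0l.
  by apply: (addIr (f 0)); rewrite -fD !add0r.
- by rewrite fD; apply: tensor_Dl.
- exact: tensor_Dr.
- by rewrite fr; apply: tensor_bal.
Qed.

Fact rscaleN (v : V) (b : B) : rscale (- v) b = - rscale v b.
Proof. by rewrite -!scaleN1r scale_rscale. Qed.

Fact topp_class s : topp (tclass s) = tclass [seq (- p.1, p.2) | p <- s].
Proof.
apply/tclassP/(tensor_rel_map (f := -%R)); last exact: treprP.
- exact: opprD.
- by move=> v b; rewrite rscaleN.
Qed.

Fact tscale_class a s :
  tscale a (tclass s) = tclass [seq (a *: p.1, p.2) | p <- s].
Proof.
apply/tclassP/(tensor_rel_map (f := *:%R a)); last exact: treprP.
- exact: scalerDr.
- by move=> v b; rewrite scale_rscale.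
Qed.

Fact taddA : associative tadd.
Proof.
by move=> x y z; rewrite -[x]treprK -[y]treprK -[z]treprK !tadd_class catA.
Qed.

Fact taddC : commutative tadd.
Proof. by move=> x y; apply/tclassP; apply: tensor_catC. Qed.

Fact tadd0 : left_id (tclass [::]) tadd.
Proof. by move=> x; rewrite -[x]treprK tadd_class. Qed.

Lemma tensor_split (f g h : V -> V) s :
  (forall v, h v = f v + g v) ->
  tensor_rel [seq (h p.1, p.2) | p <- s]
    ([seq (f p.1, p.2) | p <- s] ++ [seq (g p.1, p.2) | p <- s]).
Proof.
move=> hfg; elim: s => [|[v m] s IHs] /=; first exact: tensor_refl.
rewrite hfg -[X in tensor_rel X _]cat1s.
apply: tensor_trans (tensor_cat (tensor_Dl _ _ _) IHs) _.
set F := map _ s; set G := map _ s.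
have FG : tensor_rel ([:: (g v, m)] ++ (F ++ G)) (F ++ ([:: (g v, m)] ++ G)).
  by rewrite !catA; apply: tensor_cat; [apply: tensor_catC | apply: tensor_refl].
exact: (tensor_cat (tensor_refl [:: (f v, m)]) FG).
Qed.

Lemma tensor_rel0 (s : seq (V * M)) :
  tensor_rel [seq (0, p.2) | p <- s] [::].
Proof.
elim: s => [|p s IHs] /=; first exact: tensor_refl.
by rewrite -cat1s; apply: (tensor_cat (tensor_0l _) IHs).
Qed.

Fact taddN : left_inverse (tclass [::]) topp tadd.
Proof.
move=> x; rewrite -[x]treprK topp_class tadd_class; apply/tclassP.
apply: (tensor_trans _ (tensor_rel0 (trepr x))).
apply: tensor_sym.
rewrite -[X in _ ++ X]map_id.
have -> : [seq id p | p <- trepr x] = [seq (id p.1, p.2) | p <- trepr x].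
  by apply: eq_map => -[].
by apply: (@tensor_split -%R id (fun=> 0)) => v; rewrite addNr.
Qed.

HB.instance Definition _ := GRing.isZmodule.Build tensor taddA taddC tadd0 taddN.

Fact tscaleA a b x : tscale a (tscale b x) = tscale (a * b) x.
Proof.
rewrite -[x]treprK !tscale_class -map_comp; congr tclass.
by apply: eq_map => -[v m]; rewrite /= scalerA.
Qed.

Fact tscale1 : left_id 1 tscale.
Proof.
move=> x; rewrite -[x in LHS]treprK tscale_class -[RHS]treprK; congr tclass.
by rewrite -[RHS]map_id; apply: eq_map => -[v m]; rewrite /= scale1r.
Qed.

Fact tscaleDr : right_distributive tscale +%R.
Proof.
move=> a x y; rewrite -[x]treprK -[y]treprK [_ + _]tadd_class !tscale_class.
by rewrite [RHS]tadd_class map_cat.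
Qed.

Fact tscaleDl x : {morph tscale^~ x : a b / a + b}.
Proof.
move=> a b; rewrite -[x]treprK !tscale_class [RHS]tadd_class; apply/tclassP.
apply: (@tensor_split ( *:%R a) ( *:%R b) ( *:%R (a + b))) => v.
exact: scalerDl.
Qed.

HB.instance Definition _ := GRing.Zmodule_isLmodule.Build A tensor
  tscaleA tscale1 tscaleDr tscaleDl.

Definition pure_tensor (v : V) (m : M) : tensor := tclass [:: (v, m)].

Lemma pure_tensorDl u v m :
  pure_tensor (u + v) m = pure_tensor u m + pure_tensor v m.
Proof. by rewrite [RHS]tadd_class; apply/tclassP; apply: tensor_Dl. Qed.

Lemma pure_tensorDr v m n :
  pure_tensor v (m + n) = pure_tensor v m + pure_tensor v n.
Proof. by rewrite [RHS]tadd_class; apply/tclassP; apply: tensor_Dr. Qed.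

Lemma pure_tensor_bal v b m :
  pure_tensor (rscale v b) m = pure_tensor v (b *: m).
Proof. by apply/tclassP; apply: tensor_bal. Qed.

Lemma scale_pure_tensor a v m :
  a *: pure_tensor v m = pure_tensor (a *: v) m.
Proof. exact: tscale_class. Qed.

Lemma tclassE s : tclass s = \sum_(p <- s) pure_tensor p.1 p.2.
Proof.
elim: s => [|[v m] s IHs]; first by rewrite big_nil.
by rewrite big_cons -IHs /= [RHS]tadd_class.
Qed.

Lemma pure_tensor_gen (x : tensor) :
  exists s : seq (V * M), x = \sum_(p <- s) pure_tensor p.1 p.2.
Proof. by exists (trepr x); rewrite -tclassE treprK. Qed.

Lemma tensor_universal (W : zmodType) (f : V -> M -> W) :
  (forall u v m, f (u + v) m = f u m + f v m) ->
  (forall v m n, f v (m + n) = f v m + f v n) ->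
  (forall v b m, f (rscale v b) m = f v (b *: m)) ->
  exists g : {additive tensor -> W}, forall v m, g (pure_tensor v m) = f v m.
Proof.
move=> fDl fDr fbal.
pose F s := \sum_(p <- s) f p.1 p.2.
have Frel s1 s2 : tensor_rel s1 s2 -> F s1 = F s2.
  rewrite /F; elim=> {s1 s2} [//|s1 s2 _ -> // | s1 s2 s3 _ -> // |
    s1 s2 t1 t2 _ IH1 _ IH2 | s1 s2 | m | u v m | v m n | v b m].
  - by rewrite !big_cat /= IH1 IH2.
  - by rewrite !big_cat /= addrC.
  - rewrite big_seq1 big_nil /=.
    by apply: (addIr (f 0 m)); rewrite -fDl !add0r.
  - by rewrite big_seq1 big_cons big_seq1 /= fDl.
  - by rewrite big_seq1 big_cons big_seq1 /= fDr.
  - by rewrite !big_seq1 /= fbal.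
pose g (x : tensor) : W := F (trepr x).
have gE s : g (tclass s) = F s by apply: Frel; apply: treprP.
have gD : {morph g : x y / x + y}.
  move=> x y; rewrite -[x]treprK -[y]treprK [_ + _]tadd_class !gE.
  by rewrite /F big_cat.
have g0 : g 0 = 0 by rewrite -[0]/(tclass [::]) gE /F big_nil.
pose gm := GRing.isNmodMorphism.Build tensor W g (conj g0 gD).
pose ga : {additive tensor -> W} := HB.pack g gm.
by exists ga => v m; rewrite /= gE /F big_seq1.
Qed.

End Tensor.

(* The sequence 0 -> I -> Ga -> La -> 0, whose first map is the inclusion, is
   exact: I is the kernel of pi and pi is surjective. *)
Definition split_by_nilpotent (R : comNzRingType) (La Ga : algType R)
    (I : twosided_ideal Ga) (pi : {lrmorphism Ga -> La})
    (sigma : {lrmorphism La -> Ga}) : Prop :=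
  [/\ (forall x, x \in I -> jacobson_radical x),
      (forall x, x \in I <-> pi x = 0),
      (forall y, exists x, pi x = y) &
      (forall y, pi (sigma y) = y)].

Definition algebra_bimod (R : comNzRingType) (La Ga : algType R)
    (sigma : {lrmorphism La -> Ga}) : bimodType Ga La :=
  restr (idfun : {rmorphism Ga -> Ga}) sigma Ga^o.

Definition ideal_bimod (R : comNzRingType) (La Ga : algType R)
    (sigma : {lrmorphism La -> Ga}) (I : twosided_ideal Ga) :
    bimodType La La :=
  restr sigma sigma (ideal_sort I).

Definition induced (R : comNzRingType) (La Ga : algType R)
    (sigma : {lrmorphism La -> Ga}) (M : lmodType La) : lmodType Ga :=
  tensor (algebra_bimod sigma) M.

Definition linear_order (t : nat) (le : rel 'I_t) : Prop :=
  [/\ reflexive le, antisymmetric le, transitive le & total le].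

Definition stratifying_system (A : pzRingType) (t : nat)
    (Theta : 'I_t -> lmodType A) (le : rel 'I_t) : Prop :=
  [/\ linear_order le,
      (forall i, finitely_generated (Theta i) /\ indecomposable (Theta i)),
      (forall i j, le j i -> i != j -> hom_zero (Theta i) (Theta j)) &
      (forall i j, le j i -> ext1_zero (Theta i) (Theta j))].

Definition compatible (R : comNzRingType) (La Ga : algType R)
    (sigma : {lrmorphism La -> Ga}) (I : twosided_ideal Ga) (t : nat)
    (Theta : 'I_t -> lmodType La) (le : rel 'I_t) : Prop :=
  (forall i j, le i j -> i != j ->
     hom_zero (Theta j) (tensor (ideal_bimod sigma I) (Theta i))) /\
  (forall i j, le i j ->
     ext1_zero (Theta j) (tensor (ideal_bimod sigma I) (Theta i))).

(* Main.v *)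
Require Import Defs.
From HB Require Import structures.
From mathcomp Require Import all_boot all_order all_algebra.
From mathcomp Require Import boolp classical_sets functions.

Set Implicit Arguments.
Unset Strict Implicit.
Unset Printing Implicit Defensive.

Import GRing.Theory.
Local Open Scope ring_scope.

(* G is left adjoint to restriction of scalars along sigma, and over Lambda
   the module G(N) restricts to N (+) (I (x) N).  Hence Hom(G(M), G(N)) is
   Hom(M, N) (+) Hom(M, I (x) N).  The same holds for Ext^1: an extension of
   G(M) by X is split by pulling it back along M -> G(M); conversely an
   extension E of M by X gives, I being flat on the right, the exact sequence
   0 -> G(X) -> G(E) -> G(M) -> 0, which one pushes out along the counit
   G(X) -> X.  Finally, an idempotent e of End(G(M)) induces an idempotent of
   End(M) through G(M) / I G(M) = M; if the latter is 0 then the image of e is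
   contained in I G(M), so it vanishes by Nakayama's lemma. *)

(** * Modules and extensions *)

Lemma inj_surj_bijective (T U : Type) (f : T -> U) :
  injective f -> (forall y, exists x, f x = y) -> bijective f.
Proof.
move=> f_inj f_surj; pose g y := sval (cid (f_surj y)).
have gK : cancel g f by move=> y; rewrite /g; case: cid.
by exists g => // x; apply: f_inj; rewrite gK.
Qed.

Definition linear_of (A : pzRingType) (M N : lmodType A) (f : M -> N) 
    (f_lin : linear f) : {linear M -> N} :=
  HB.pack f (GRing.isLinear.Build A M N *:%R f f_lin).

Lemma linear_bijective_inv (A : pzRingType) (M N : lmodType A)
    (f : {linear M -> N}) :
  bijective f -> exists2 g : {linear N -> M}, cancel f g & cancel g f.
Proof.
case=> g fK gK.
have g_lin : linear g by move=> a x y; apply: (can_inj fK); rewrite linearP !gK.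
by exists (linear_of g_lin).
Qed.

Section SubQuotient.
Variables (A : pzRingType) (M : lmodType A) (S : {pred M}).
Hypothesis S_closed : submod_closed S.

#[local] HB.instance Definition _ := GRing.isSubmodClosed.Build A M S S_closed.

Record submodule := Submodule { submodule_val : M; _ : submodule_val \in S }.

#[local] HB.instance Definition _ := [isSub for submodule_val].
#[local] HB.instance Definition _ := [Choice of submodule by <:].
#[local] HB.instance Definition _ := [SubChoice_isSubLmodule of submodule by <:].

(** A submodule is handled only as an injective linear map with prescribed image, so the subtype and
    its local instances stay hidden from later proofs. *)
Lemma submodule_exists : exists (K : lmodType A) (i : {linear K -> M}),
  injective i /\ forall x, x \in S <-> exists k, i k = x.
Proof.
exists submodule, (linear_of (@linearP _ _ _ _ (\val : submodule -> M))).
split=> [|x]; first exact: val_inj.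
by split=> [Sx | [[k Sk] <- //]]; exists (Submodule Sx).
Qed.

Local Notation Q := (Quotient.quot S).

Definition qscale a (x : Q) : Q := (\pi_Q (a *: repr x))%qT.

(** Independent of the representative: two of them differ by an element of [S], which is stable
    under scalars. *)
Lemma qscale_pi a x : qscale a (\pi_Q x)%qT = (\pi_Q (a *: x))%qT.
Proof.
apply/eqP; rewrite -Quotient.idealrBE -scalerBr rpredZ //.
by rewrite Quotient.idealrBE reprK.
Qed.

Fact qscaleA a b x : qscale a (qscale b x) = qscale (a * b) x.
Proof. by rewrite -[x]reprK (qscale_pi b) !qscale_pi scalerA. Qed.
Fact qscale1 : left_id 1 qscale.
Proof. by move=> x; rewrite -[x]reprK qscale_pi scale1r. Qed.
Fact qscaleDr : right_distributive qscale +%R.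
Proof.
move=> a x y; rewrite -[x]reprK -[y]reprK -raddfD !qscale_pi.
by rewrite -raddfD scalerDr.
Qed.
Fact qscaleDl x : {morph qscale^~ x : a b / a + b}.
Proof.
by move=> a b; rewrite -[x]reprK !qscale_pi -raddfD scalerDl.
Qed.

Lemma quotient_exists : exists (P : lmodType A) (p : {linear M -> P}),
  (forall y, exists x, p x = y) /\ forall x, p x = 0 <-> x \in S.
Proof.
pose mix := GRing.Zmodule_isLmodule.Build A Q qscaleA qscale1 qscaleDr qscaleDl.
pose P : lmodType A := HB.pack Q mix.
have p_lin : linear (fun x => (\pi_Q x)%qT : P).
  by move=> a x y; rewrite raddfD; congr (_ + _); apply/esym/qscale_pi.
exists P, (linear_of p_lin); split=> [y | x] /=.
  by exists (repr y); apply: reprK.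
have -> : (0 : P) = (\pi_Q 0)%qT by rewrite raddf0.
by rewrite -[X in X \in S]subr0 Quotient.idealrBE; split=> [-> | /eqP].
Qed.
End SubQuotient.

(** * Splittings of short exact sequences *)

Section Extensions.
Variables (A : pzRingType) (M N : lmodType A).
Implicit Types (E : extension M N).

Lemma ext_projI E y : ext_proj E (ext_inj E y) = 0.
Proof. by apply/ext_exact; exists y. Qed.

(** The isomorphism sends [e] to [(r e, ext_proj E e)]. Its kernel lies in the image of [N], where
    [r] is injective; to reach [(y, x)], a lift of [x] is corrected by an element of [N]. *)
Lemma retract_split E (r : {linear ext_mid E -> N}) :
  (forall y, r (ext_inj E y) = y) -> ext_equiv E (split_extension M N).
Proof.
move=> rK.
have phi_lin : linear (fun e => (r e, ext_proj E e)).
  by move=> a x y; rewrite !linearP.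
exists (linear_of phi_lin); split=> //= [|y]; last by rewrite rK ext_projI.
apply: inj_surj_bijective => [x y [rxy pxy] | [y x]].
  apply/eqP; rewrite -subr_eq0; apply/eqP.
  have /ext_exact[z zE] : ext_proj E (x - y) = 0 by rewrite linearB pxy subrr.
  by rewrite -zE -[z]rK zE linearB rxy subrr linear0.
have [e <-] := ext_projS E x; exists (e + ext_inj E (y - r e)) => /=.
by rewrite (linearD r) (linearD (ext_proj E)) ext_projI rK addr0 addrC subrK.
Qed.

(** Retractions are easier to transport than equivalences of extensions; this is the form in which
    vanishing of Ext^1 is proved below. *)
Lemma ext1_zeroP :
  ext1_zero M N <->
  forall E, exists r : {linear ext_mid E -> N}, forall y, r (ext_inj E y) = y.
Proof.
split=> [MN0 E | retr E]; last by have [r /retract_split] := retr E.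
have [phi [_ phiI _]] := MN0 E.
by exists (fst \o phi) => y; rewrite /= phiI.
Qed.

Lemma ext1_zero_section : ext1_zero M N -> forall E,
  exists s : {linear M -> ext_mid E}, forall x, ext_proj E (s x) = x.
Proof.
move=> MN0 E; have [phi [/linear_bijective_inv[psi _ psiK] _ phiP]] := MN0 E.
have s_lin : linear (fun x => psi (0, x)).
  move=> a x y; rewrite -linearP; congr (psi (_, _)).
  by rewrite /= scaler0 addr0.
by exists (linear_of s_lin) => x; rewrite -phiP /= psiK.
Qed.

(** The difference [e - s (ext_proj E e)] lies in the kernel of the projection, so it comes from a
    unique element of [N], which is taken as [r e]. *)
Lemma section_retract E (s : {linear M -> ext_mid E}) :
  (forall x, ext_proj E (s x) = x) ->
  exists r : {linear ext_mid E -> N}, forall y, r (ext_inj E y) = y.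
Proof.
move=> sK.
have rP e : exists y, ext_inj E y = e - s (ext_proj E e).
  by apply/ext_exact; rewrite linearB sK subrr.
pose r e := sval (cid (rP e)).
have rE e : ext_inj E (r e) = e - s (ext_proj E e) by rewrite /r; case: cid.
have r_lin : linear r.
  move=> a x y; apply: (@ext_injI _ _ _ E).
  rewrite (linearP (ext_inj E)) !rE (linearP (ext_proj E)) (linearP s).
  by rewrite opprD addrACA -scalerN -scalerDr.
exists (linear_of r_lin) => y; apply: (@ext_injI _ _ _ E).
by rewrite rE ext_projI linear0 subr0.
Qed.
End Extensions.

(** The pushout [P] of [E] along [f], the quotient of N' x E by the pairs [(f y, - i y)], is an
    extension of [M] by [N']. A retraction of it, composed with E -> P, extends [f]. *)
Lemma ext1_zero_extend (A : pzRingType) (M N N' : lmodType A)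
    (E : extension M N) (f : {linear N -> N'}) : ext1_zero M N' ->
  exists r : {linear ext_mid E -> N'}, forall y, r (ext_inj E y) = f y.
Proof.
move=> MN'0; set i := ext_inj E; set p := ext_proj E.
pose S : {pred N' * ext_mid E} :=
  [pred z | `[< exists y, z = (f y, - i y) >]].
have S_closed : submod_closed S.
  split=> [|a u v].
    by apply/asboolP; exists 0; rewrite (linear0 f) (linear0 i) oppr0.
  move=> /asboolP[y ->] /asboolP[z ->]; apply/asboolP; exists (a *: y + z).
  by rewrite (linearP f) (linearP i) opprD -scalerN.
have [P [q [q_surj qE]]] := quotient_exists S_closed.
have inj_lin : linear (fun x => q (x, 0)).
  move=> a x y; rewrite -linearP; congr (q (_, _)).
  by rewrite /= scaler0 addr0.
(* Well-definedness of the projection P -> M: two representatives of [z] differ by some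
   [(f y, - i y)], and [p] kills [i y]. *)
have proj_ex z : exists x, forall w e, q (w, e) = z -> x = p e.
  have [[w e] qwe] := q_surj z; exists (p e) => w' e' qwe'.
  have /qE/asboolP[y [_ eE]] : q ((w, e) - (w', e')) = 0.
    by rewrite linearB qwe qwe' subrr.
  apply/eqP; rewrite -subr_eq0 -linearB eE linearN ext_projI.
  by rewrite oppr0.
pose pr z := sval (cid (proj_ex z)).
have prE w e : pr (q (w, e)) = p e.
  by rewrite /pr; case: cid => x /= /(_ w e) ->.
have pr_lin : linear pr.
  move=> a z z'; have [[w e] <-] := q_surj z; have [[w' e'] <-] := q_surj z'.
  by rewrite -linearP !prE linearP.
have injI : injective (linear_of inj_lin).
  move=> x y /= qxy; apply/eqP; rewrite -subr_eq0.
  have /qE/asboolP[z [-> /esym]] : q ((x, 0) - (y, 0)) = 0.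
    by rewrite linearB qxy subrr.
  rewrite subr0 => /eqP; rewrite oppr_eq0 -(linear0 i).
  by move=> /eqP/(@ext_injI _ _ _ E) ->; rewrite linear0.
have projS x : exists z, linear_of pr_lin z = x.
  by have [e <-] := ext_projS E x; exists (q (0, e)); apply: prE.
have exact z : linear_of pr_lin z = 0 <-> exists y, linear_of inj_lin y = z.
  have [[w e] <-] := q_surj z; rewrite /= prE.
  split=> [/ext_exact[y <-] | [y yE]].
    exists (w + f y); apply/eqP; rewrite -subr_eq0 -linearB; apply/eqP/qE.
    apply/asboolP; exists y; congr pair => /=; last by rewrite sub0r.
    by rewrite addrC addKr.
  by rewrite -(prE w) -yE prE linear0.
have [/= r rE] := (iffLR (ext1_zeroP M N') MN'0) (Extension injI projS exact).
have s_lin : linear (fun e => r (q (0, e))).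
  move=> a x y; rewrite -linearP -linearP; congr (r (q (_, _))).
  by rewrite /= scaler0 addr0.
exists (linear_of s_lin) => y /=; rewrite -(rE (f y)) /=; congr (r _).
apply/eqP; rewrite eq_sym -subr_eq0 -linearB; apply/eqP/qE/asboolP; exists y.
by congr pair; rewrite /= ?subr0 ?sub0r.
Qed.

(** [N'] is a retract of [N]: extend [f] from [N'] to the middle term, then return by [g]. *)
Lemma ext1_zero_retract (A : pzRingType) (M N N' : lmodType A)
    (f : {linear N' -> N}) (g : {linear N -> N'}) :
  cancel f g -> ext1_zero M N -> ext1_zero M N'.
Proof.
move=> fK MN0; apply/ext1_zeroP => E.
have [r rE] := ext1_zero_extend E f MN0.
by exists (g \o r) => y; rewrite /= rE fK.
Qed.

(** * Flatness of projective bimodules *)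

(** All elements of [P] serve as generators. The free module on them, realized as finitely supported
    functions, maps onto [P]; a section of this map has the coordinates [phi x]. Any longer
    duplicate-free list is allowed, so that several elements can share one list. *)
Lemma dual_basis (A : pzRingType) (P : lmodType A) : projective_module P ->
  exists phi : P -> {linear P -> A^o}, forall v, exists s : seq P,
  forall r, uniq r -> {subset s <= r} -> v = \sum_(x <- r) (phi x v : A) *: x.
Proof.
move=> P_proj.
pose fin_supp : {pred P -> A^o} :=
  [pred f : P -> A^o |
     `[< exists s : seq P, forall x, x \notin s -> f x = 0 >]].
have fin_supp_closed : submod_closed fin_supp.
  split=> [|a f g]; first by apply/asboolP; exists [::].
  move=> /asboolP[s f0] /asboolP[t g0]; apply/asboolP; exists (s ++ t) => x.
  rewrite mem_cat negb_or => /andP[/f0 fx0 /g0 gx0].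
  by rewrite -[LHS]/(a *: f x + g x) fx0 gx0 scaler0 addr0.
have [F [i [i_inj iE]]] := submodule_exists fin_supp_closed.
have supp k : exists s : seq P, forall x, x \notin s -> i k x = 0.
  by have /asboolP := iffRL (iE (i k)) (ex_intro _ k erefl).
(* A formal sum is evaluated on a chosen support; [sumFE] shows that every duplicate-free list
   outside which the function vanishes gives the same value. *)
pose sumF k : P := \sum_(x <- undup (sval (cid (supp k)))) (i k x : A) *: x.
have sumFE k r : uniq r -> (forall x, x \notin r -> i k x = 0) ->
    sumF k = \sum_(x <- r) (i k x : A) *: x.
  move=> r_uniq r0; rewrite /sumF; case: cid => s /= s0.
  rewrite [LHS](bigID (fun x => i k x == 0)) [RHS](bigID (fun x => i k x == 0)).
  rewrite /= [X in X + _]big1 ?[X in _ = X + _]big1 ?add0r; first last.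
  - by move=> x /eqP ->; rewrite scale0r.
  - by move=> x /eqP ->; rewrite scale0r.
  rewrite -[LHS]big_filter -[RHS]big_filter; apply: perm_big.
  apply: uniq_perm; rewrite ?filter_uniq ?undup_uniq // => x.
  rewrite !mem_filter mem_undup; case: eqVneq => //= kx.
  case: (boolP (x \in s)) => [_ | /s0/eqP]; last by rewrite (negPf kx).
  by case: (boolP (x \in r)) => // /r0/eqP; rewrite (negPf kx).
have sumF_lin : linear sumF.
  move=> a k l; have [s s0] := supp k; have [t t0] := supp l.
  pose r := undup (s ++ t).
  have rs x : x \notin r -> x \notin s.
    by apply: contra; rewrite mem_undup mem_cat => ->.
  have rt x : x \notin r -> x \notin t.
    by apply: contra; rewrite mem_undup mem_cat orbC => ->.
  have iP x : i (a *: k + l) x = a *: i k x + i l x by rewrite linearP.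
  rewrite (sumFE (a *: k + l) r) ?undup_uniq //; last first.
    by move=> x xr; rewrite iP s0 ?t0 ?scaler0 ?addr0 ?rs ?rt.
  rewrite (sumFE k r) ?undup_uniq //; last by move=> x /rs/s0.
  rewrite (sumFE l r) ?undup_uniq //; last by move=> x /rt/t0.
  rewrite scaler_sumr -big_split; apply: eq_bigr => x _ /=.
  by rewrite iP scalerA -scalerDl.
have [|h hK] := P_proj F P (linear_of sumF_lin) idfun.
  (* The indicator function of [y] is a preimage of [y]. *)
  move=> y; have [|k kE] := iffLR (iE (fun x => if x == y then 1 else 0)).
  - apply/asboolP; exists [:: y] => x; rewrite inE => /negPf ->; exact: erefl.
  exists k; rewrite /= (sumFE _ [:: y]) // ?big_seq1 ?kE ?eqxx ?scale1r //.
  by move=> x; rewrite inE => /negPf ->.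
have phi_lin x : linear (fun v => i (h v) x).
  by move=> a u v; rewrite !linearP.
exists (fun x => linear_of (phi_lin x)) => v; have [s s0] := supp (h v).
exists s => r r_uniq sr; rewrite -[LHS]hK /=; apply: sumFE => // x xr.
by apply: s0; apply: contra xr; apply: sr.
Qed.

Lemma tensor_ext (A B : pzRingType) (V : bimodType A B) (M : lmodType B)
    (W : zmodType) (f g : {additive tensor V M -> W}) :
  (forall v m, f (pure_tensor v m) = g (pure_tensor v m)) -> f =1 g.
Proof.
move=> fg x; have [s ->] := pure_tensor_gen x.
by rewrite !raddf_sum; apply: eq_bigr.
Qed.

(* With a dual basis (x, phi_x) of V, every z in V (x) M is the sum of the
   x (x) (phi_x (x) 1) z, and the maps phi_x (x) 1 commute with 1 (x) j. *)
Lemma projective_flat (A B : pzRingType) (V : bimodType A B) (M N : lmodType B)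
    (j : {linear M -> N}) (g : {additive tensor V M -> tensor V N}) :
  projective_module (right_module V) -> injective j ->
  (forall v m, g (pure_tensor v m) = pure_tensor v (j m)) -> injective g.
Proof.
move=> /dual_basis[phi phiE] j_inj gE.
have ev (L : lmodType B) x : exists T : {additive tensor V L -> L},
    forall v m, T (pure_tensor v m) = (phi x v : B) *: m.
  apply: (tensor_universal (f := fun v m => (phi x v : B) *: m)).
  - by move=> u v m; rewrite linearD scalerDl.
  - by move=> v m n; rewrite scalerDr.
  (* [rscale v b] is the scalar multiple [b *: v] over the converse ring, whose product of [b] and
     [phi x v] is [phi x v * b] in [B]. *)
  - move=> v b m; rewrite scalerA; congr (_ *: _).
    exact: (linearZ_LR (phi x) b v).
pose T L x := sval (cid (ev L x)).
have TE L x v m : T L x (pure_tensor v m) = (phi x v : B) *: m.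
  by rewrite /T; case: cid.
have jT x z : j (T M x z) = T N x (g z).
  apply: (tensor_ext (f := j \o T M x) (g := T N x \o g)) => v m /=.
  by rewrite gE !TE linearZ.
have zE z : exists r : seq V, z = \sum_(x <- r) pure_tensor x (T M x z).
  have [s zE] := pure_tensor_gen z.
  pose supp v := sval (cid (phiE v)).
  (* One list for all terms of [z]: it contains the support of each first component occurring in
     [s]. *)
  exists (undup (flatten [seq supp p.1 | p <- s])); set r := undup _.
  transitivity (\sum_(x <- r) \sum_(p <- s)
                  pure_tensor x ((phi x p.1 : B) *: p.2)).
    rewrite exchange_big {}zE big_seq [RHS]big_seq.
    apply: eq_bigr => -[v m] sv /=.
    have {1}-> : v = \sum_(x <- r) rscale x (phi x v : B).
      apply: (svalP (cid (phiE v))) (undup_uniq _) _.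
      move=> x vx; rewrite mem_undup; apply/flattenP.
      by exists (supp v) => //; apply: (map_f (fun p => supp p.1) sv).
    rewrite (big_morph (fun v => pure_tensor v m) (id1 := 0) (op1 := +%R)).
    - by apply: eq_bigr => x _; rewrite pure_tensor_bal.
    - by move=> u u'; rewrite pure_tensorDl.
    - by apply: (addIr (pure_tensor 0 m)); rewrite -pure_tensorDl !add0r.
  apply: eq_bigr => x _; rewrite [in RHS]zE raddf_sum.
  rewrite (big_morph (pure_tensor x) (id1 := 0) (op1 := +%R)).
  - by apply: eq_bigr => p _; rewrite TE.
  - by move=> m m'; rewrite pure_tensorDr.
  - by apply: (addIr (pure_tensor x 0)); rewrite -pure_tensorDr !add0r.
apply: raddf_inj => z gz0; have [r ->] := zE z; apply: big1 => x _.
have -> : T M x z = 0 by apply: j_inj; rewrite jT gz0 !raddf0.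
by apply: (addIr (pure_tensor x 0)); rewrite -pure_tensorDr !add0r.
Qed.

(** * Nakayama's lemma and idempotents *)

Lemma maximal_left_ideal_exists (A : pzRingType) (K : set A) :
  left_ideal K -> ~ K 1 -> exists2 J, maximal_left_ideal J & (K `<=` J)%classic.
Proof.
move=> K_ideal K1.
pose proper J := [/\ left_ideal J, ~ J 1 & (K `<=` J)%classic].
(* Zorn_bigcup also requires the union of the empty chain to qualify. *)
pose P : set (set A) := [set J | J = set0 \/ proper J]%classic.
have [|J [PJ J_max]] := @Zorn_bigcup A P.
  move=> F FP F_tot.
  have [[X FX [z Xz]] | F0] := pselect (exists2 X, F X & exists z, X z);
      last first.
    left; apply/seteqP; split=> [x [X FX Xx]|//].
    by apply: F0; exists X => //; exists x.
  have propF Y y : F Y -> Y y -> proper Y.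
    by move=> FY Yy; have [Y0|//] := FP Y FY; move: Yy; rewrite Y0.
  have [[X0 _ _] _ KX] := propF X z FX Xz.
  right; split; last by move=> x /KX; exists X.
  - split=> [|x y [Y FY Yx] [Z FZ Zy]|a x [Y FY Yx]]; first by exists X.
      have [[_ YD _] _ _] := propF Y x FY Yx.
      have [[_ ZD _] _ _] := propF Z y FZ Zy.
      have [YZ|ZY] := F_tot Y Z FY FZ.
        by exists Z => //; apply: ZD => //; apply: YZ.
      by exists Y => //; apply: YD => //; apply: ZY.
    by have [[_ _ YM] _ _] := propF Y x FY Yx; exists Y => //; apply: YM.
  - by move=> [Y FY Y1]; have [_] := propF Y 1 FY Y1.
have {PJ} [J_ideal J1 KJ] : proper J.
  case: PJ => // J0; case: (J_max K); last by right; split.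
  rewrite J0; split=> // K0; have [/K0] := K_ideal; exact.
exists J => //; split=> // [|L L_ideal JL].
  by move=> JT; apply: J1; rewrite JT.
have [L1|L1] := pselect (L 1).
  right; apply/seteqP; split=> // a _; rewrite -[a]mulr1.
  by have [_ _ LM] := L_ideal; apply: LM.
left; apply: contrapT => LJ; apply: (J_max L); last first.
  by right; split=> // x /KJ/JL.
by split=> // LJ'; apply: LJ; apply/seteqP.
Qed.

(** Otherwise the left ideal generated by [1 - x] is proper and lies in a maximal left ideal, which
    also contains [x] and hence 1. *)
Lemma jacobson_radical_left_inv (A : pzRingType) (x : A) :
  jacobson_radical x -> exists y, y * (1 - x) = 1.
Proof.
move=> Jx; apply: contrapT => no_inv.
have K_ideal : left_ideal [set a | exists y, a = y * (1 - x)]%classic.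
  split=> [|_ _ [y ->] [z ->]|a _ [y ->]]; first by exists 0; rewrite mul0r.
  - by exists (y + z); rewrite mulrDl.
  - by exists (a * y); rewrite mulrA.
have [|J J_max KJ] := maximal_left_ideal_exists K_ideal.
  by move=> [y yE]; apply: no_inv; exists y.
have [[J0 JD JM] JT _] := J_max; apply: JT; apply/seteqP; split=> // a _.
rewrite -[a]mulr1; apply: JM; rewrite -[1](subrK x); apply: JD; last exact: Jx.
by apply: KJ; exists 1; rewrite mul1r.
Qed.

(** Induction on the number of generators: the last one is a combination of all of them with
    coefficients in [I], and since 1 minus its own coefficient is left invertible, it is
    redundant. *)
Lemma nakayama (A : pzRingType) (I : twosided_ideal A) (X : lmodType A) :
  (forall a, a \in I -> jacobson_radical a) -> finitely_generated X ->
  (forall x : X, exists2 s : seq (A * X),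
     {in s, forall p, p.1 \in I} & x = \sum_(p <- s) p.1 *: p.2) ->
  zero_module X.
Proof.
move=> I_rad [n [e gen]] IX; elim: n => [|n IHn] in e gen *.
  by move=> x; have [c ->] := gen x; rewrite big_ord0.
(* Expanding [y] in [a *: y] over the generators keeps the coefficients in [I], a right ideal. *)
have genI x : exists2 c : 'I_n.+1 -> A,
    forall i, c i \in I & x = \sum_i c i *: e i.
  have [s sI ->] := IX x; elim: s => [|[a y] s IHs] in sI *.
    exists (fun=> 0) => [i|]; first exact: ideal0.
    by rewrite big_nil big1 // => i _; rewrite scale0r.
  rewrite big_cons; have [|c cI ->] := IHs.
    by move=> p ps; apply: sI; rewrite inE ps orbT.
  have [d yE] := gen y; exists (fun i => a * d i + c i) => [i|].
    apply: idealD (cI i); apply: Defs.idealMr.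
    by apply: (sI (a, y)); rewrite inE eqxx.
  rewrite yE scaler_sumr -big_split; apply: eq_bigr => i _ /=.
  by rewrite scalerDl scalerA.
have [c cI eE] := genI (e ord_max).
have [y yE] := jacobson_radical_left_inv (I_rad _ (cI ord_max)).
pose e' (i : 'I_n) := e (widen_ord (leqnSn n) i).
(* Move the last term to the left and multiply by the left inverse [y] of [1 - c ord_max]. *)
have {}eE : e ord_max = \sum_(i < n) (y * c (widen_ord (leqnSn n) i)) *: e' i.
  rewrite -[LHS]scale1r -yE -scalerA scalerBl scale1r.
  rewrite {1}eE big_ord_recr /= addrK scaler_sumr.
  by apply: eq_bigr => i _; rewrite scalerA.
apply: (IHn e') => x; have [d ->] := gen x.
exists (fun i => d (widen_ord (leqnSn n) i)
                 + d ord_max * (y * c (widen_ord (leqnSn n) i))).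
rewrite big_ord_recr /= eE scaler_sumr -big_split; apply: eq_bigr => i _ /=.
by rewrite scalerDl scalerA.
Qed.

(** A decomposition gives the idempotent projecting onto [N1]. Conversely [M] is the direct sum of
    the fixed points of [u], which form its image, and of its kernel. *)
Lemma indecomposableP (A : pzRingType) (M : lmodType A) :
  indecomposable M <->
  ~ zero_module M /\ forall u : {linear M -> M}, (forall x, u (u x) = u x) ->
    (forall x, u x = 0) \/ (forall x, u x = x).
Proof.
split=> -[M_neq0 M_indec]; (split; first by []); last first.
  move=> N1 N2 [f f_bij].
  have [g fK gK] := linear_bijective_inv f_bij.
  have u_lin : linear (fun x => g ((f x).1, 0)).
    move=> a x y; rewrite (linearP f) -(linearP g); congr (g (_, _)).
    by rewrite /= scaler0 addr0.
  have [x|u0|u1] := M_indec (linear_of u_lin).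
  - by rewrite /= gK.
  - left=> x; have := u0 (g (x, 0)); rewrite /= gK => /(congr1 f).
    by rewrite gK linear0 => -[].
  - right=> y; have := u1 (g (0, y)); rewrite /= gK => /(congr1 f).
    by rewrite !gK => -[].
move=> u uu.
pose S1 : {pred M} := [pred x | u x == x].
pose S2 : {pred M} := [pred x | u x == 0].
have S1_closed : submod_closed S1.
  split=> [|a x y]; rewrite !inE ?linear0 // => /eqP ux /eqP uy.
  by rewrite linearP ux uy.
have S2_closed : submod_closed S2.
  split=> [|a x y]; rewrite !inE ?linear0 // => /eqP ux /eqP uy.
  by rewrite linearP ux uy scaler0 addr0.
have [N1 [i1 [i1_inj i1E]]] := submodule_exists S1_closed.
have [N2 [i2 [i2_inj i2E]]] := submodule_exists S2_closed.
have ui1 k : u (i1 k) = i1 k.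
  by apply/eqP; have := iffRL (i1E (i1 k)) (ex_intro _ k erefl).
have ui2 k : u (i2 k) = 0.
  by apply/eqP; have := iffRL (i2E (i2 k)) (ex_intro _ k erefl).
have g_lin : linear (fun p : N1 * N2 => i1 p.1 + i2 p.2).
  by move=> a p q; rewrite !linearP scalerDr addrACA.
have im1 x : exists k, i1 k = u x by apply/i1E; rewrite inE uu.
have im2 x : exists k, i2 k = x - u x.
  by apply/i2E; rewrite inE linearB uu subrr.
have g_bij : bijective (linear_of g_lin).
  apply: inj_surj_bijective => [[a b] [a' b'] /= gE | x]; last first.
    have [[k kE] [l lE]] := (im1 x, im2 x).
    by exists (k, l); rewrite /= kE lE addrC subrK.
  have aa' : a = a'.
    apply: i1_inj; rewrite -[LHS]ui1 -[RHS]ui1.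
    by have := congr1 u gE; rewrite !linearD !ui2 !addr0.
  by rewrite aa' in gE *; congr pair; apply/i2_inj/(addrI _ gE).
have [f fK gK] := linear_bijective_inv g_bij.
have [|N1_0|N2_0] := M_indec N1 N2.
- by exists f; exists (linear_of g_lin).
- by left=> x; have [k <-] := im1 x; rewrite (N1_0 k) linear0.
- right=> x; apply/esym/eqP; rewrite -subr_eq0; have [k <-] := im2 x.
  by rewrite (N2_0 k) linear0.
Qed.

(** * Restriction and induction of scalars *)

(** A separate name for the carrier, so that the pulled-back action does not clash with the original
    one. *)
Definition restriction (A' A : pzRingType) (f : {rmorphism A' -> A})
  (X : lmodType A) : Type := X.

Section Restriction.
Variables (A' A : pzRingType) (f : {rmorphism A' -> A}) (X : lmodType A).

HB.instance Definition _ := GRing.Zmodule.on (restriction f X).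

Let scale (a : A') (x : restriction f X) : restriction f X := f a *: (x : X).

Fact restriction_scaleA a b x : scale a (scale b x) = scale (a * b) x.
Proof. by rewrite /scale scalerA rmorphM. Qed.
Fact restriction_scale1 : left_id 1 scale.
Proof. by move=> x; rewrite /scale rmorph1 scale1r. Qed.
Fact restriction_scaleDr : right_distributive scale +%R.
Proof. by move=> a x y; apply: scalerDr. Qed.
Fact restriction_scaleDl x : {morph scale^~ x : a b / a + b}.
Proof. by move=> a b; rewrite /scale rmorphD; apply: scalerDl. Qed.

HB.instance Definition _ := GRing.Zmodule_isLmodule.Build A' (restriction f X)
  restriction_scaleA restriction_scale1 restriction_scaleDr restriction_scaleDl.
End Restriction.

Lemma restriction_linear (A' A : pzRingType) (f : {rmorphism A' -> A})
    (X Y : lmodType A) (h : {linear X -> Y}) :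
  linear (h : restriction f X -> restriction f Y).
Proof. by move=> a x y; apply: linearP. Qed.

(** The map [s] stands for the action of [a] on [W], possibly through a ring morphism; thus one
    statement serves linearity over both algebras. *)
Lemma tensor_morph (A B : pzRingType) (V : bimodType A B) (M : lmodType B)
    (W : zmodType) (h : {additive tensor V M -> W}) (a : A)
    (s : {additive W -> W}) :
  (forall v m, h (pure_tensor (a *: v) m) = s (h (pure_tensor v m))) ->
  forall z, h (a *: z) = s (h z).
Proof.
move=> hs z; apply: (tensor_ext (f := h \o *:%R a) (g := s \o h)) => v m /=.
by rewrite scale_pure_tensor hs.
Qed.

Section Induced.
Variables (R : comNzRingType) (La Ga : algType R).
Variable sigma : {lrmorphism La -> Ga}.
Implicit Types (M N : lmodType La) (X : lmodType Ga).

Local Notation G := (induced sigma).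
Local Notation res X := (restriction sigma X).

Definition ind_tensor M (c : Ga) (m : M) : G M :=
  pure_tensor (c : algebra_bimod sigma) m.

Lemma ind_tensorDl M c d (m : M) :
  ind_tensor (c + d) m = ind_tensor c m + ind_tensor d m.
Proof. exact: pure_tensorDl. Qed.

Lemma ind_tensorDr M c (m n : M) :
  ind_tensor c (m + n) = ind_tensor c m + ind_tensor c n.
Proof. exact: pure_tensorDr. Qed.

Lemma ind_tensor0 M c : ind_tensor c (0 : M) = 0.
Proof. by apply: (addIr (ind_tensor c 0)); rewrite -ind_tensorDr !add0r. Qed.

Lemma ind_tensor_bal M c b (m : M) :
  ind_tensor (c * sigma b) m = ind_tensor c (b *: m).
Proof. exact: pure_tensor_bal. Qed.

Lemma scale_ind_tensor M a c (m : M) :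
  a *: ind_tensor c m = ind_tensor (a * c) m.
Proof. exact: scale_pure_tensor. Qed.

Lemma ind_tensorE M c (m : M) : ind_tensor c m = c *: ind_tensor 1 m.
Proof. by rewrite scale_ind_tensor mulr1. Qed.

Lemma ind_tensor_ext M (W : zmodType) (f g : {additive G M -> W}) :
  (forall c m, f (ind_tensor c m) = g (ind_tensor c m)) -> f =1 g.
Proof. exact: (tensor_ext (V := algebra_bimod sigma)). Qed.

Lemma restriction_ind_ext M (W : zmodType) (f g : {additive res (G M) -> W}) :
  (forall c m, f (ind_tensor c m) = g (ind_tensor c m)) -> f =1 g.
Proof. exact: (@ind_tensor_ext M W f g). Qed.

Lemma ind_unit_linear M : linear (ind_tensor 1 : M -> res (G M)).
Proof.
move=> a m n; rewrite ind_tensorDr -ind_tensor_bal mul1r ind_tensorE.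
exact: erefl.
Qed.
Definition ind_unit M : {linear M -> res (G M)} :=
  linear_of (@ind_unit_linear M).

(** The transpose under the adjunction of induction and restriction; it is balanced because [La]
    acts on the restriction through [sigma]. *)
Lemma ind_adjoint M X (f : {linear M -> res X}) :
  exists g : {linear G M -> X}, forall c m, g (ind_tensor c m) = c *: (f m : X).
Proof.
have [||c b m|g gE] := @tensor_universal Ga La (algebra_bimod sigma) M X
    (fun c m => (c : Ga) *: (f m : X)).
- by move=> c d m; rewrite scalerDl.
- by move=> c m n; rewrite linearD; apply: scalerDr.
- have -> : f (b *: m) = sigma b *: (f m : X) := linearZ_LR f b m.
  exact/esym/scalerA.
have g_lin : linear g.
  move=> a x y; rewrite raddfD; congr (_ + _).
  apply: (tensor_morph (s := *:%R a)) => v m.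
  by rewrite /= !gE; apply/esym/scalerA.
by exists (linear_of g_lin).
Qed.

Lemma induced_map M N (f : {linear M -> N}) :
  exists g : {linear G M -> G N}, forall c m,
  g (ind_tensor c m) = ind_tensor c (f m).
Proof.
have [g gE] := ind_adjoint (ind_unit N \o f).
by exists g => c m; rewrite gE [RHS]ind_tensorE.
Qed.

Lemma hom_zero_induced M X : hom_zero (G M) X <-> hom_zero M (res X).
Proof.
split=> [GX0 f m | MX0 g]; last first.
  apply: (ind_tensor_ext (g := \0)) => c m.
  rewrite /= ind_tensorE linearZ /=.
  have -> : g (ind_tensor 1 m) = 0.
    exact: (MX0 (linear_of (restriction_linear g) \o ind_unit M) m).
  exact: scaler0.
have [g gE] := ind_adjoint f.
by have := gE 1 m; rewrite GX0 scale1r.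
Qed.

(** A section of the pullback of [E] along the unit M -> G(M), composed with the map to the middle
    term of [E], has as transpose a section of [E]. *)
Lemma ext1_zero_induced M X : ext1_zero M (res X) -> ext1_zero (G M) X.
Proof.
move=> MX0; apply/ext1_zeroP => E.
(* The pullback, as a submodule of the product. *)
pose S : {pred res (ext_mid E) * M} :=
  [pred z | ext_proj E z.1 == ind_tensor 1 z.2].
have S_closed : submod_closed S.
  split=> [|a x y].
    by rewrite inE linear0 ind_tensor0.
  rewrite !inE => /eqP xS /eqP yS.
  rewrite (linearP (linear_of (restriction_linear (f := sigma) (ext_proj E)))) /=.
  rewrite xS yS; apply/eqP/esym; exact: (linearP (ind_unit M)).
have [K [i [i_inj iE]]] := submodule_exists S_closed.
have SK k : ext_proj E (i k).1 = ind_tensor 1 (i k).2.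
  by apply/eqP; have := iffRL (iE (i k)) (ex_intro _ k erefl).
have injS (x : X) : exists k, i k = (ext_inj E x, 0).
  by apply/iE; rewrite inE /= ext_projI ind_tensor0.
pose inj (x : res X) := sval (cid (injS x)).
have injE x : i (inj x) = (ext_inj E x, 0) by rewrite /inj; case: cid.
have inj_lin : linear inj.
  move=> a x y; apply: i_inj; rewrite linearP !injE; congr pair.
    exact: (linearP (ext_inj E)).
  by rewrite /= scaler0 addr0.
have injI : injective (linear_of inj_lin).
  move=> x y /= /(congr1 i); rewrite !injE => -[].
  exact: (@ext_injI _ _ _ E).
have projS m : exists k, (snd \o i) k = m.
  have [e eE] := ext_projS E (ind_tensor 1 m).
  have [|k kE] := iffLR (iE (e, m)); first by rewrite inE eE.
  by exists k; rewrite /= kE.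
have exact k : (snd \o i) k = 0 <-> exists x, linear_of inj_lin x = k.
  split=> [/= k0 | [x <-]]; last by rewrite /= injE.
  have /ext_exact[x xE] : ext_proj E (i k).1 = 0.
    by rewrite SK k0 ind_tensor0.
  exists x; apply: i_inj; rewrite injE xE -k0.
  by case: (i k).
have [s sK] := ext1_zero_section MX0 (Extension injI projS exact).
have [g gE] := ind_adjoint (fst \o (i \o s)).
apply: (@section_retract _ _ _ E g).
apply: (ind_tensor_ext (f := ext_proj E \o g) (g := idfun)) => c m.
rewrite /= gE linearZ /= SK [RHS]ind_tensorE; congr (_ *: ind_tensor _ _).
exact: sK.
Qed.

(** Let [q] be the cokernel of [i]. Lifting elements of [M] to the middle term and applying [q]
    gives a well-defined map on [M], whose transpose [h] satisfies h p = q. So the kernel of [p]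
    lies in that of [q], the image of [i]. *)
Lemma induced_right_exact M N (E : extension M N)
    (i : {linear G N -> G (ext_mid E)}) (p : {linear G (ext_mid E) -> G M}) :
  (forall c y, i (ind_tensor c y) = ind_tensor c (ext_inj E y)) ->
  (forall c e, p (ind_tensor c e) = ind_tensor c (ext_proj E e)) ->
  forall z, p z = 0 <-> exists w, i w = z.
Proof.
move=> iE pE z; split=> [pz0 | [w <-]]; last first.
  apply: (ind_tensor_ext (f := p \o i) (g := \0)) => c y /=.
  by rewrite iE pE ext_projI ind_tensor0.
pose S : {pred G (ext_mid E)} := [pred z | `[< exists w, i w = z >]].
have S_closed : submod_closed S.
  split=> [|a x y]; first by apply/asboolP; exists 0; rewrite linear0.
  move=> /asboolP[w <-] /asboolP[v <-]; apply/asboolP; exists (a *: w + v).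
  by rewrite linearP.
have [Q [q [_ qE]]] := quotient_exists S_closed.
have q0 c (e e' : ext_mid E) : ext_proj E e = ext_proj E e' ->
    q (ind_tensor c e) = q (ind_tensor c e').
  move=> ee'; have /ext_exact[y yE] : ext_proj E (e - e') = 0.
    by rewrite linearB ee' subrr.
  rewrite -[e](subrK e') -yE ind_tensorDr linearD.
  rewrite (iffRL (qE _)) ?add0r //; apply/asboolP.
  by exists (ind_tensor c y); rewrite iE.
pose lift m := sval (cid (ext_projS E m)).
have liftE m : ext_proj E (lift m) = m by rewrite /lift; case: cid.
have f_lin : linear ((fun m => q (ind_tensor 1 (lift m))) : M -> res Q).
  move=> a m n; rewrite (q0 _ _ (a *: lift m + lift n)).
    rewrite [ind_tensor _ _](linearP (ind_unit _) a (lift m) (lift n)).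
    exact: (linearP (linear_of (restriction_linear (f := sigma) q))).
  by rewrite linearP !liftE.
have [h hE] := ind_adjoint (linear_of f_lin).
have hp : h \o p =1 q.
  apply: (ind_tensor_ext (f := h \o p)) => c e /=.
  by rewrite pE hE /= -linearZ -ind_tensorE; apply: q0; rewrite liftE.
by have /qE/asboolP : q z = 0 by rewrite -hp /= pz0 linear0.
Qed.
End Induced.

(** * Split extensions *)

Section SplitByNilpotent.
Variables (R : comNzRingType) (La Ga : algType R) (I : twosided_ideal Ga).
Variables (pi : {lrmorphism Ga -> La}) (sigma : {lrmorphism La -> Ga}).
Hypothesis piK : forall y, pi (sigma y) = y.
Hypothesis IE : forall x, x \in I <-> pi x = 0.
Implicit Types (M N : lmodType La) (X : lmodType Ga).

Local Notation G := (induced sigma).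
Local Notation res X := (restriction sigma X).
Local Notation ind_tensor := (ind_tensor sigma).
Local Notation ind_unit := (ind_unit sigma).
Local Notation "I '(x)' M" := (tensor (ideal_bimod sigma I) M)
  (at level 40, only parsing).

Lemma ind_proj_exists M : exists eps : {linear res (G M) -> M},
  forall c m, eps (ind_tensor c m) = pi c *: m.
Proof.
have [||c b m|g gE] := @tensor_universal Ga La (algebra_bimod sigma) M M
    (fun c m => pi (c : Ga) *: m).
- by move=> c d m; rewrite raddfD scalerDl.
- by move=> c m n; rewrite scalerDr.
- by rewrite scalerA -{2}[b]piK -rmorphM.
have g_lin : linear (g : res (G M) -> M).
  move=> a x y; rewrite raddfD; congr (_ + _).
  apply: (tensor_morph (a := sigma a) (s := *:%R a)) => c m.
  rewrite !gE /= scalerA; congr (_ *: _).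
  by rewrite -{2}[a]piK -rmorphM.
by exists (linear_of g_lin).
Qed.

Lemma ideal_part_subproof c : c - sigma (pi c) \in I.
Proof. by apply/IE; rewrite raddfB /= piK subrr. Qed.

(** The component of [c] in [I] for the decomposition of [Ga] as I (+) sigma(La). *)
Definition ideal_part c : ideal_bimod sigma I :=
  IdealSort (ideal_part_subproof c).

Lemma ideal_incl_exists M : exists kappa : {linear I (x) M -> res (G M)},
  forall (x : ideal_sort I) m,
  kappa (pure_tensor (x : ideal_bimod sigma I) m) = ind_tensor (\val x) m.
Proof.
have [||c b m|g gE] := @tensor_universal La La (ideal_bimod sigma I) M (G M)
    (fun x m => ind_tensor (\val (x : ideal_sort I)) m).
- by move=> c d m; apply: ind_tensorDl.
- by move=> c m n; apply: ind_tensorDr.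
- exact: ind_tensor_bal.
have g_lin : linear (g : I (x) M -> res (G M)).
  move=> a x y; rewrite raddfD; congr (_ + _).
  apply: (tensor_morph (s := *:%R (sigma a))) => c m.
  by rewrite !gE; apply/esym/scale_ind_tensor.
by exists (linear_of g_lin).
Qed.

(** [ideal_part] commutes with the left and right actions of [La], so it can be tensored with
    [M]. *)
Lemma ideal_proj_exists M : exists rho : {linear res (G M) -> I (x) M},
  forall c m, rho (ind_tensor c m) = pure_tensor (ideal_part c) m.
Proof.
have [||c b m|g gE] := @tensor_universal Ga La (algebra_bimod sigma) M
    (I (x) M) (fun c m => pure_tensor (ideal_part (c : Ga)) m).
- move=> c d m; rewrite -pure_tensorDl; congr (pure_tensor _ m).
  by apply: val_inj; rewrite /= !raddfD /= addrACA.
- by move=> c m n; apply: pure_tensorDr.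
- rewrite -pure_tensor_bal; congr (pure_tensor _ m).
  by apply: val_inj; rewrite /= !rmorphM /= piK mulrBl.
have g_lin : linear (g : res (G M) -> I (x) M).
  move=> a x y; rewrite raddfD; congr (_ + _).
  apply: (tensor_morph (a := sigma a) (s := *:%R a)) => c m.
  rewrite !gE /= scale_pure_tensor; congr (pure_tensor _ m).
  by apply: val_inj; rewrite /= !rmorphM /= piK mulrBr.
by exists (linear_of g_lin).
Qed.

Definition ind_proj M := sval (cid (ind_proj_exists M)).
Definition ideal_incl M := sval (cid (ideal_incl_exists M)).
Definition ideal_proj M := sval (cid (ideal_proj_exists M)).

Lemma ind_projE M c m : ind_proj M (ind_tensor c m) = pi c *: m.
Proof. by rewrite /ind_proj; case: cid. Qed.

(** Linearity over all of [Ga], acting on [M] through [pi], and not only over [La]. *)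
Lemma ind_projZ M c (z : G M) : ind_proj M (c *: z) = pi c *: ind_proj M z.
Proof.
apply: (tensor_morph (h := ind_proj M) (s := *:%R (pi c))) => d m /=.
by rewrite !ind_projE scalerA -rmorphM.
Qed.

Lemma ideal_inclE M (x : ideal_sort I) m :
  ideal_incl M (pure_tensor (x : ideal_bimod sigma I) m)
  = ind_tensor (\val x) m.
Proof. by rewrite /ideal_incl; case: cid. Qed.

Lemma ideal_projE M c m :
  ideal_proj M (ind_tensor c m) = pure_tensor (ideal_part c) m.
Proof. by rewrite /ideal_proj; case: cid. Qed.

Lemma ind_unitK M : cancel (ind_unit M) (ind_proj M).
Proof. by move=> m; rewrite [LHS]ind_projE rmorph1 scale1r. Qed.

Lemma ideal_inclK M : cancel (ideal_incl M) (ideal_proj M).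
Proof.
apply: (tensor_ext (f := ideal_proj M \o ideal_incl M) (g := idfun)) => x m /=.
rewrite ideal_inclE ideal_projE; congr (pure_tensor _ m); apply: val_inj => /=.
by rewrite (iffLR (IE _) (ideal_valP x)) raddf0 subr0.
Qed.

(** On generators, c (x) m = (c - sigma(pi c)) (x) m + 1 (x) pi(c) m. With [ind_unitK] and
    [ideal_inclK], this is the form in which the splitting of G(M) is used. *)
Lemma ind_decomp M (z : res (G M)) :
  z = ideal_incl M (ideal_proj M z) + ind_unit M (ind_proj M z).
Proof.
pose f : {linear res (G M) -> res (G M)} :=
  (ideal_incl M \o ideal_proj M) \+ (ind_unit M \o ind_proj M).
apply: (restriction_ind_ext (f := idfun) (g := f)) => c m; rewrite /f /=.
rewrite ideal_projE ideal_inclE ind_projE -ind_tensor_bal mul1r -ind_tensorDl.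
by rewrite subrK.
Qed.
Lemma ideal_unit_hom_zero M N :
  hom_zero M (res (G N)) <-> hom_zero M N /\ hom_zero M (I (x) N).
Proof.
split=> [MG0 | [MN0 MI0] f m].
  split=> f m.
    rewrite -[f m]ind_unitK [ind_unit N _](MG0 (ind_unit N \o f)).
    by rewrite linear0.
  rewrite -[f m]ideal_inclK [ideal_incl N _](MG0 (ideal_incl N \o f)).
  by rewrite linear0.
rewrite [LHS]ind_decomp [ideal_proj N _](MI0 (ideal_proj N \o f)).
rewrite [ind_proj N _](MN0 (ind_proj N \o f)).
by rewrite !linear0 addr0.
Qed.

(** Both summands are retracts of G(N). Conversely, the two projections of G(N) are extended
    separately along [E], and the sum of the results is a retraction. *)
Lemma ideal_unit_ext1_zero M N :
  ext1_zero M (res (G N)) <-> ext1_zero M N /\ ext1_zero M (I (x) N).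
Proof.
split=> [MG0 | [MN0 MI0]].
  split; first exact: ext1_zero_retract (@ind_unitK N) MG0.
  exact: ext1_zero_retract (@ideal_inclK N) MG0.
apply/ext1_zeroP => E.
have [r rE] := ext1_zero_extend E (ideal_proj N) MI0.
have [s sE] := ext1_zero_extend E (ind_proj N) MN0.
exists ((ideal_incl N \o r) \+ (ind_unit N \o s)) => y.
by rewrite [RHS]ind_decomp /= rE sE.
Qed.

(** * Exactness of induction and Ext^1, for [I] projective on the right *)

Section Flat.
Hypothesis I_proj : projective_module (right_module (ideal_bimod sigma I)).

(** Through the two projections, [g] acts as [f] on [M] and as the tensor product of [I] with [f] on
    I (x) M, which is injective by [projective_flat]. *)
Lemma induced_injective M N (f : {linear M -> N}) (g : {linear G M -> G N}) :
  (forall c m, g (ind_tensor c m) = ind_tensor c (f m)) ->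
  injective f -> injective g.
Proof.
move=> gE f_inj.
have [||c b m|h hE] := @tensor_universal La La (ideal_bimod sigma I) M
    (I (x) N) (fun x m => pure_tensor x (f m)).
- by move=> x y m; apply: pure_tensorDl.
- by move=> x m n; rewrite linearD pure_tensorDr.
- by rewrite linearZ pure_tensor_bal.
have h_inj := projective_flat I_proj f_inj hE.
pose g' := linear_of (restriction_linear (f := sigma) g).
have ind_projg z : ind_proj N (g' z) = f (ind_proj M z).
  apply: (restriction_ind_ext (f := ind_proj N \o g') (g := f \o ind_proj M)).
  move=> c m /=.
  by rewrite gE !ind_projE linearZ.
have ideal_projg z : ideal_proj N (g' z) = h (ideal_proj M z).
  apply: (restriction_ind_ext (f := ideal_proj N \o g')
                              (g := h \o ideal_proj M)).
  move=> c m /=.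
  by rewrite gE !ideal_projE hE.
apply: raddf_inj => z gz0; rewrite [LHS]ind_decomp.
have -> : ideal_proj M z = 0.
  by apply: h_inj; rewrite -ideal_projg /= gz0 !raddf0.
have -> : ind_proj M z = 0.
  by apply: f_inj; rewrite -ind_projg /= gz0 !raddf0.
by rewrite !linear0 addr0.
Qed.

Lemma ext1_zero_induced_iff M X :
  ext1_zero (G M) X <-> ext1_zero M (res X).
Proof.
split=> [GX0 | ]; last exact: ext1_zero_induced.
apply/ext1_zeroP => E.
have [i iE] := induced_map sigma (ext_inj E).
have [p pE] := induced_map sigma (ext_proj E).
have p_surj z : exists w, p w = z.
  have [s ->] := pure_tensor_gen z; elim: s => [|[c m] s [w wE]].
    by exists 0; rewrite linear0 big_nil.
  have [e eE] := ext_projS E m; exists (ind_tensor c e + w).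
  by rewrite big_cons linearD wE pE eE.
have i_inj := induced_injective iE (@ext_injI _ _ _ E).
(* The counit G(X) -> X, as the transpose of the identity. *)
have [c cE] := ind_adjoint
  (linear_of (restriction_linear (f := sigma) (idfun : {linear X -> X}))).
have [r rE] := ext1_zero_extend
  (Extension i_inj p_surj (induced_right_exact iE pE)) c GX0.
(* Restricting [r] along the unit suffices, as the counit sends 1 (x) y to [y]. *)
exists (linear_of (restriction_linear (f := sigma) r) \o ind_unit _) => y /=.
by rewrite -iE rE cE /= scale1r.
Qed.
End Flat.

(** * Finite generation and indecomposability of induced modules *)

Lemma induced_finitely_generated M :
  finitely_generated M -> finitely_generated (G M).
Proof.
move=> [n [e gen]]; exists n, (fun i => ind_tensor 1 (e i)) => z.
have [s ->] := pure_tensor_gen z; elim: s => [|[c m] s [d dE]].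
  by exists (fun=> 0); rewrite big_nil big1 // => i _; rewrite scale0r.
have [b mE] := gen m; exists (fun i => c * sigma (b i) + d i).
rewrite big_cons dE -[pure_tensor _ _]/(ind_tensor c m) ind_tensorE mE.
rewrite [ind_tensor _ _](linear_sum (ind_unit M)) scaler_sumr -big_split.
apply: eq_bigr => i _ /=.
rewrite scalerDl -scalerA; congr (_ *: _ + _).
exact: (linearZ_LR (ind_unit M)).
Qed.

Hypothesis I_rad : forall x, x \in I -> jacobson_radical x.

(* The image K of e satisfies K = I K because e sends 1 (x) m into
   ker(Gamma (x) M -> M) = I (Gamma (x) M). *)
Lemma induced_idempotent_eq0 M (e : {linear G M -> G M}) :
  finitely_generated M -> (forall z, e (e z) = e z) ->
  (forall m, ind_proj M (e (ind_tensor 1 m)) = 0) -> forall z, e z = 0.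
Proof.
move=> M_fg ee e0.
have proj_e z : ind_proj M (e z) = 0.
  pose e' := linear_of (restriction_linear (f := sigma) e).
  apply: (restriction_ind_ext (f := ind_proj M \o e') (g := \0)) => c m /=.
  by rewrite ind_tensorE linearZ /= ind_projZ e0 scaler0.
pose S : {pred G M} := [pred z | e z == z].
have S_closed : submod_closed S.
  split=> [|a x y]; rewrite !inE ?linear0 // => /eqP ux /eqP uy.
  by rewrite linearP ux uy.
have [K [i [i_inj iE]]] := submodule_exists S_closed.
have ei k : e (i k) = i k.
  by apply/eqP; have := iffRL (iE (i k)) (ex_intro _ k erefl).
have im z : exists k, i k = e z by apply/iE; rewrite inE ee.
suff K0 : zero_module K.
  by move=> z; have [k <-] := im z; rewrite (K0 k) linear0.
have [q qE] : exists q : {linear G M -> K}, forall z, i (q z) = e z.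
  pose q z := sval (cid (im z)).
  have qE z : i (q z) = e z by rewrite /q; case: cid.
  have q_lin : linear q.
    by move=> a x y; apply: i_inj; rewrite linearP !qE linearP.
  by exists (linear_of q_lin).
have qi k : q (i k) = k by apply: i_inj; rewrite qE ei.
apply: (nakayama I_rad) => [|k].
  have [n [g gen]] := induced_finitely_generated M_fg.
  exists n, (q \o g) => k; have [d dE] := gen (i k); exists d.
  rewrite -[LHS]qi dE linear_sum; apply: eq_bigr => j _.
  exact: linearZ.
(* The component of [i k] in [M] vanishes, so [i k] is a sum of x (x) m = x (1 (x) m) with [x] in
   [I]; applying [q] exhibits [k] as an element of I K. *)
have kE : i k = ideal_incl M (ideal_proj M (i k)).
  rewrite [LHS]ind_decomp -{2}[i k]ei proj_e.
  by rewrite (linear0 (ind_unit M)) addr0.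
have [s sE] := pure_tensor_gen (ideal_proj M (i k)).
exists [seq (\val (p.1 : ideal_sort I), q (ind_tensor 1 p.2)) | p <- s].
  by move=> _ /mapP[p _ ->]; apply: ideal_valP.
rewrite big_map -[LHS]qi kE sE (linear_sum (ideal_incl M)).
rewrite (linear_sum q); apply: eq_bigr => p _ /=.
by rewrite ideal_inclE ind_tensorE linearZ.
Qed.
(** An idempotent [u] of [M] is recovered from G(u) by projecting. An idempotent [e] of G(M) induces
    [ebar] on [M]: if [ebar] is 0, so is [e]; if [ebar] is the identity, the same argument applies
    to 1 - e. *)
Lemma induced_indecomposable M : finitely_generated M ->
  indecomposable (G M) <-> indecomposable M.
Proof.
move=> M_fg; split=> /indecomposableP[neq0 indec]; apply/indecomposableP; split.
- move=> M0; apply: neq0 => z.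
  apply: (ind_tensor_ext (f := idfun) (g := \0)) => c m /=.
  by rewrite (M0 m) ind_tensor0.
- move=> u uu; have [g gE] := induced_map sigma u.
  have uE m : u m = ind_proj M (g (ind_tensor 1 m)).
    by rewrite gE ind_projE rmorph1 scale1r.
  have [z | g0 | g1] := indec g.
  + apply: (ind_tensor_ext (f := g \o g) (g := g)) => c m /=.
    by rewrite !gE uu.
  + by left=> m; rewrite uE g0 linear0.
  + by right=> m; rewrite uE g1 ind_projE rmorph1 scale1r.
- move=> G0; apply: neq0 => m.
  by rewrite -[m]ind_unitK [ind_unit M m]G0 linear0.
move=> e ee; pose e' := linear_of (restriction_linear (f := sigma) e).
pose ebar : {linear M -> M} := ind_proj M \o (e' \o ind_unit M).
have ebarE z : ind_proj M (e z) = ebar (ind_proj M z).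
  apply: (restriction_ind_ext (f := ind_proj M \o e')
                              (g := ebar \o ind_proj M)).
  move=> c m /=.
  rewrite [X in e X]ind_tensorE linearZ /= ind_projZ ind_projE.
  exact/esym/(linearZ_LR ebar).
have [m | ebar0 | ebar1] := indec ebar.
- by rewrite {1}[ebar m]/= -ebarE ee.
- by left; apply: induced_idempotent_eq0.
- right=> z; apply/esym/eqP; rewrite -subr_eq0; apply/eqP.
  apply: (induced_idempotent_eq0 (e := idfun \- e)) => // [w|m] /=.
    by rewrite linearB ee subrr subr0.
  rewrite linearB ind_projE rmorph1 scale1r.
  by rewrite [X in _ - X](ebar1 m) subrr.
Qed.
End SplitByNilpotent.

Theorem proposition5p2
    (R : comNzRingType) (La Ga : algType R)
    (artin_La : artin_algebra La) (artin_Ga : artin_algebra Ga)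
    (I : twosided_ideal Ga)
    (pi : {lrmorphism Ga -> La}) (sigma : {lrmorphism La -> Ga})
    (split_ext : split_by_nilpotent I pi sigma)
    (I_projective : projective_module (right_module (ideal_bimod sigma I)))
    (t : nat) (Theta : 'I_t -> lmodType La)
    (Theta_fg : forall i, finitely_generated (Theta i))
    (le : rel 'I_t) (le_linear : linear_order le) :
  stratifying_system (fun i => induced sigma (Theta i)) le
  <->
  stratifying_system Theta le /\ compatible sigma I Theta le.
Proof.
have [I_rad IE _ piK] := split_ext.
have indecE i : indecomposable (induced sigma (Theta i)) <->
    indecomposable (Theta i).
  exact: (induced_indecomposable piK IE I_rad (Theta_fg i)).
have homE i j : hom_zero (induced sigma (Theta i)) (induced sigma (Theta j)) <->
    hom_zero (Theta i) (Theta j) /\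
    hom_zero (Theta i) (tensor (ideal_bimod sigma I) (Theta j)).
  apply: iff_trans (ideal_unit_hom_zero piK IE _ _); exact: hom_zero_induced.
have extE i j : ext1_zero (induced sigma (Theta i)) (induced sigma (Theta j)) <->
    ext1_zero (Theta i) (Theta j) /\
    ext1_zero (Theta i) (tensor (ideal_bimod sigma I) (Theta j)).
  apply: iff_trans (ideal_unit_ext1_zero piK IE _ _).
  exact: ext1_zero_induced_iff.
split=> [[_ indec hom ext] | [[_ indec hom ext] [homI extI]]].
  split; split=> // i; first by have [_ /indecE] := indec i.
  - by move=> j ji ij; have /homE[] := hom i j ji ij.
  - by move=> j ji; have /extE[] := ext i j ji.
  (* Compatibility tests the larger index [j] against I (x) Theta(i), hence the exchanged
     indices. *)
  - move=> j ij neq_ij; apply: (proj2 (iffLR (homE j i) _)).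
    by apply: hom => //; rewrite eq_sym.
  - by move=> j ij; apply: (proj2 (iffLR (extE j i) _)); apply: ext.
split=> // i.
- have [fg /indecE] := indec i.
  by split=> //; apply: induced_finitely_generated.
- move=> j ji neq_ij; apply/homE; split; first exact: hom.
  by apply: homI => //; rewrite eq_sym.
- by move=> j ji; apply/extE; split; [apply: ext | apply: extI].
Qed.
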